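(* Let $n\ge 1$ be an integer, let $0<\alpha,\beta<n$ be real numbers, let $C_1,C_2>0$, and put $q_{n,\alpha,\beta}=(4n-4\alpha+2\beta)/\beta$. Then for every $q$ with $q_{n,\alpha,\beta}\le q\le\infty$ there is a constant $C$, depending only on $n,\alpha,\beta,q,C_1,C_2$ (and not on $|\mathbb{F}|$ or $\mu$), such that the following holds. For every field $\mathbb{F}$ of prime order and every probability measure $\mu$ on $\mathbb{F}^n$ satisfying $$\mu(x)\le C_1|\mathbb{F}|^{-\alpha}\quad\text{for all }x\in\mathbb{F}^n$$ and $$|\widehat{\mu}(\xi)|\le C_2|\mathbb{F}|^{-\beta/2}\quad\text{for all }\xi\in\mathbb{F}^n,\ \xi\ne 0,$$ one has $R^*_\mu(2\to q)\le C$.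
   Context: $\mathbb{F}$ is the finite field with $|\mathbb{F}|$ elements, $|\mathbb{F}|$ prime. A measure on $\mathbb{F}^n$ is a function $\mu:\mathbb{F}^n\to[0,\infty)$; it is a probability measure if $\sum_{x\in\mathbb{F}^n}\mu(x)=1$. For $x,\xi\in\mathbb{F}^n$ let $x\cdot\xi=x_1\xi_1+\cdots+x_n\xi_n \pmod{|\mathbb{F}|}$ and $e(-x\cdot\xi)=e^{-2\pi i\, x\cdot\xi/|\mathbb{F}|}$. For $f:\mathbb{F}^n\to\mathbb{C}$, $$\widehat{f\mu}(\xi)=\sum_{x\in\mathbb{F}^n}e(-x\cdot\xi)f(x)\mu(x),\qquad \widehat{\mu}(\xi)=\sum_{x\in\mathbb{F}^n}e(-x\cdot\xi)\mu(x).$$ Norms: $\|f\|_{L^q(\mathbb{F}^n)}=\big(\sum_x|f(x)|^q\big)^{1/q}$ and $\|f\|_{L^q(\mu)}=\big(\sum_x|f(x)|^q\mu(x)\big)^{1/q}$, with the usual (essential) supremum when $q=\infty$. For $1\le p,q\le\infty$, $R^*_\mu(p\to q)$ is the smallest constant $R$ such that $\|\widehat{f\mu}\|_{L^q(\mathbb{F}^n)}\le R\,\|f\|_{L^p(\mu)}$ for all complex functions $f$ on the support of $\mu$. *)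

(* Defs.v *)
From HB Require Import structures.
From mathcomp Require Import all_boot all_order all_algebra.
From mathcomp Require Import all_classical all_reals all_analysis.
From mathcomp Require Import complex.

Set Implicit Arguments.
Unset Strict Implicit.
Unset Printing Implicit Defensive.

Import Order.TTheory GRing.Theory Num.Theory.
Import ComplexField.Normc.

Local Open Scope classical_set_scope.
Local Open Scope ring_scope.
Local Open Scope complex_scope.

(* The prime p is the order of the field: for p prime, 'F_p has p elements and
   the coercion 'F_p -> nat picks the representative in [0, p[. *)

Definition dotp (p n : nat) (x xi : 'rV['F_p]_n) : 'F_p :=
  \sum_(i < n) x ord0 i * xi ord0 i.

(* e(t) = exp(2 pi i t / p). *)
Definition echar (R : realType) (p : nat) (t : 'F_p) : R[i] :=
  let theta : R := 2 * pi * (t : nat)%:R / p%:R in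
  (cos theta) +i* (sin theta).

Definition fourier (R : realType) (p n : nat) (g : 'rV['F_p]_n -> R[i])
    (xi : 'rV['F_p]_n) : R[i] :=
  \sum_(x : 'rV['F_p]_n) echar R (- dotp x xi) * g x.

Definition probability_density (R : realType) (T : finType) (mu : T -> R) :=
  (forall x, 0 <= mu x) /\ \sum_(x : T) mu x = 1.

(* The L^q norm with respect to the measure with point masses w; the value at
   -oo is a dummy. *)
Definition Lqnorm (R : realType) (T : finType) (w : T -> R) (q : \bar R)
    (f : T -> R[i]) : R :=
  match q with
  | r%:E => (\sum_(x : T) normc (f x) `^ r * w x) `^ r^-1
  | +oo%E => \big[Num.max/0]_(x : T | w x != 0) normc (f x)
  | -oo%E => 0
  end.

(* The best constant in the extension inequality. The infimum is taken in
   \bar R, so it is +oo if no constant is admissible. The values of f off the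
   support of mu affect neither side of the inequality, so f may be taken to be
   defined everywhere. *)
Definition Rstar (R : realType) (p n : nat) (mu : 'rV['F_p]_n -> R)
    (r q : \bar R) : \bar R :=
  ereal_inf [set A%:E | A in [set A : R | 0 <= A /\
    forall f : 'rV['F_p]_n -> R[i],
      Lqnorm (fun=> 1) q (fourier (fun x => f x * (mu x)%:C))
        <= A * Lqnorm mu r f]].

Definition qexp (R : realType) (n : nat) (alpha beta : R) : R :=
  (4 * n%:R - 4 * alpha + 2 * beta) / beta.

(* Main.v *)
Require Import Defs.
From HB Require Import structures.
From mathcomp Require Import all_boot all_order all_algebra.
From mathcomp Require Import all_classical all_reals all_analysis.
From mathcomp Require Import complex.
From mathcomp Require Import ring lra.

(** The operator f |-> fourier (f mu) has TT* operator: convolution with the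
    Fourier transform of mu. Write mu = 1/N + nu with N = p^n. By Plancherel the
    uniform part 1/N contributes the identity operator, which maps l^s to its
    dual with norm at most 1 for s <= 2. The part nu gives a kernel
    K xi eta = fourier nu (eta - xi) that satisfies two estimates:
    - |K| <= A := C2 p^(-beta/2), since the transform of nu vanishes at 0 and is
      that of mu elsewhere ([dual_estimate]);
    - the bilinear form of K is bounded on l^2 by B := (C1 + 1) p^(n - alpha), a
      bound for N |nu|, again by Plancherel ([fourier_form_l2]).
    Interpolation between these two bounds makes the form bounded on l^s with
    constant c_s A^(2/s - 1) B^(2 - 2/s) for 1 < s < 2
    ([bilinear_interpolation]). If s is the exponent dual to
    r = (4n - 4 alpha + 2 beta)/beta, then the powers of p in this constant
    cancel exactly, so that the bound is uniform in p and mu. Duality gives the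
    extension inequality into l^r ([extension_of_dual]), and the larger
    exponents follow because the l^q norms for counting measure decrease in q
    ([Lqnorm_counting_le]).

    The interpolation is done with real methods. With |g xi| rounded down to its
    dyadic level, the form is cut at |g xi| |g eta| = lam. Above the cut the sup
    bound on K is used pointwise, and s > 1 makes this part a negative power of
    lam. Below it g is split into its levels, and the l^2 bound is applied to each
    level against everything under the cut; since s < 2, the sums over levels are
    geometric, so that no logarithm appears at the endpoint r. The best lam
    balances the two parts. *)

Set Implicit Arguments.
Unset Strict Implicit.
Unset Printing Implicit Defensive.

Import Order.TTheory GRing.Theory Num.Theory.
Import ComplexField.Normc.

Local Open Scope classical_set_scope.
Local Open Scope ring_scope.
Local Open Scope complex_scope.

(** * Sums of powers, dyadic levels, moduli *)

(** Nesting of the l^q norms for counting measure: each a x is at most the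
    total. *)
Lemma sum_powR_le (R : realType) (T : finType) (a : T -> R) (r : R) :
  (forall x, 0 <= a x) -> 1 <= r ->
  \sum_x a x `^ r <= (\sum_x a x) `^ r.
Proof.
move=> a0 r1; have r0 : 0 < r by apply: lt_le_trans r1.
have S0 : 0 <= \sum_x a x by apply: sumr_ge0.
rewrite -(mulr_powRB1 S0 r0) mulr_suml; apply: ler_sum => x _.
rewrite -(mulr_powRB1 (a0 x) r0); apply: ler_wpM2l => //.
apply: ge0_ler_powR; rewrite ?nnegrE ?subr_ge0 //.
by rewrite (bigD1 x) //= lerDl sumr_ge0.
Qed.

(** The terms below Y form a tail of the geometric progression, so its largest
    term controls the sum, whatever the starting point w is. *)
Lemma geometric_sum_below (R : realType) (w rho Y : R) (L : nat) :
  0 <= w -> 0 <= rho < 1 -> 0 <= Y ->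
  \sum_(k < L | w * rho ^+ k <= Y) w * rho ^+ k <= Y / (1 - rho).
Proof.
move=> w0 /andP[rho0 rho1] Y0; elim: L w w0 => [|L IH] w w0.
  by rewrite big_ord0 divr_ge0 // subr_ge0 ltW.
have r1 : 0 < 1 - rho by rewrite subr_gt0.
have [wY|Yw] := leP w Y.
  apply: (@le_trans _ _ (\sum_(k < L.+1) w * rho ^+ k)).
    rewrite big_mkcond /=; apply: ler_sum => k _.
    by case: ifP => // _; rewrite mulr_ge0 // exprn_ge0.
  rewrite -mulr_sumr ler_pdivlMr // -mulrA mulrC.
  have -> : (\sum_(k < L.+1) rho ^+ k) * (1 - rho) = 1 - rho ^+ L.+1.
    by rewrite mulrC -opprB mulNr -subrX1 opprB.
  apply: (le_trans _ wY); rewrite -[leRHS]mul1r ler_wpM2r //.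
  by rewrite lerBlDr lerDl exprn_ge0.
rewrite big_mkcond big_ord_recl /= expr0 mulr1 (lt_geF Yw) add0r -big_mkcond /=.
have := IH (w * rho) (mulr_ge0 w0 rho0).
congr (_ <= _); apply: eq_big => [k|k _]; rewrite ?exprS mulrA //.
Qed.

Lemma dyadic_level (R : realType) (M a : R) :
  0 < a -> a <= 2 * M -> exists k, M * 2^-1 ^+ k <= a <= 2 * (M * 2^-1 ^+ k).
Proof.
move=> a0 aM.
have ex : exists k, M * 2^-1 ^+ k <= a.
  have [m hm] : exists m : nat, M / a <= m%:R.
    exists (Num.truncn (M / a)).+1; exact/ltW/truncnS_gt.
  exists m; rewrite exprVn ler_pdivrMr ?exprn_gt0 //.
  move: hm; rewrite ler_pdivrMr // mulrC => /le_trans; apply.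
  rewrite ler_wpM2l ?(ltW a0) // -natrX ler_nat; exact/ltnW/ltn_expl.
case: (ex_minnP ex) => -[|k] hk kmin; [exists 0%N | exists k.+1].
  by rewrite hk expr0 mulr1.
rewrite hk /=; have : ~~ (M * 2^-1 ^+ k <= a).
  by apply/negP => /kmin; rewrite ltnn.
rewrite -ltNge => /ltW /le_trans; apply.
rewrite exprS; set z := _ ^+ k.
by have -> : 2 * (M * (2^-1 * z)) = M * z by field.
Qed.

Lemma normc_ge0 (R : rcfType) (z : R[i]) : 0 <= normc z.
Proof. by case: z => a b; exact: sqrtr_ge0. Qed.

(** The triangle inequality on R[i] itself rather than on its normed alias. *)
Lemma normcD_le (R : rcfType) (x y : R[i]) : normc (x + y) <= normc x + normc y.
Proof. exact: le_normcD. Qed.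

Lemma normc_sum (R : rcfType) (I : finType) (P : pred I) (F : I -> R[i]) :
  normc (\sum_(i | P i) F i) <= \sum_(i | P i) normc (F i).
Proof.
elim/big_ind2: _ => [|x a y b xa yb|//]; first by rewrite normc0.
exact: le_trans (normcD_le a b) (lerD xa yb).
Qed.

(** * Bilinear interpolation *)

(** Half the sum of the two losses of the dyadic decomposition: the factor 2
    between a value and its level, raised to the power 2 - s, and the sum of the
    geometric series over the levels. *)
Definition interp_const (R : realType) (s : R) : R :=
  (2 `^ (2 - s) + (1 - 2^-1 `^ (2 - s))^-1) / 2.

Lemma half_powR_lt1 (R : realType) (e : R) : 0 < e -> 2^-1 `^ e < 1.
Proof.
move=> e0; apply: (@lt_le_trans _ _ (1 `^ e)); last by rewrite powR1.
by apply: gt0_ltr_powR => //; rewrite ?nnegrE; lra.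
Qed.

Lemma interp_const_ge0 (R : realType) (s : R) : s < 2 -> 0 <= interp_const s.
Proof.
move=> s2; rewrite /interp_const divr_ge0 // addr_ge0 ?powR_ge0 //.
by rewrite invr_ge0 subr_ge0 ltW // half_powR_lt1 // subr_gt0.
Qed.

Section Interpolation.
Variables (R : realType) (T : finType) (K : T -> T -> R[i]) (A B s : R).
Hypotheses (A0 : 0 < A) (B0 : 0 < B) (s1 : 1 < s) (s2 : s < 2).

Let form (u v : T -> R[i]) := \sum_x \sum_y u x * v y * K x y.

Hypothesis KA : forall x y, normc (K x y) <= A.
(** The l^2 bound B |u| |v|, with the weight t that optimises it left free. *)
Hypothesis KB : forall u v t, 0 < t -> normc (form u v) <=
  B / 2 * (t * \sum_x normc (u x) ^+ 2 + t^-1 * \sum_y normc (v y) ^+ 2).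

(** The pair to keep in mind is a function and its conjugate. *)
Variables (g h : T -> R[i]).
Hypothesis hg : forall x, normc (h x) = normc (g x).

Let a x := normc (g x).
Let S := \sum_x a x `^ s.

(** Where the product P of the two moduli is at least lam, P is at most
    lam^(1-s) P^s since s > 1; summing P^s gives the square of S. *)
Lemma above_cut_bound (above : rel T) (lam : R) : 0 < lam ->
  (forall x y, 0 < a x -> above x y -> lam <= a x * a y) ->
  normc (\sum_x \sum_(y | above x y) g x * h y * K x y)
    <= A * lam `^ (1 - s) * S ^+ 2.
Proof.
move=> lam0 habove; apply: le_trans (normc_sum _ _) _.
rewrite expr2 {1}/S mulr_suml mulr_sumr; apply: ler_sum => x _.
apply: le_trans (normc_sum _ _) _; rewrite mulr_sumr mulr_sumr big_mkcond /=.
apply: ler_sum => y _; have a0 z : 0 <= a z by exact: normc_ge0.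
have [ax|] := boolP (0 < a x); last first.
  rewrite lt0r a0 andbT negbK => /eqP /eq0_normc ->.
  by rewrite !mul0r normc0 if_same !mulr_ge0 ?powR_ge0 // ltW.
case: ifPn => [/(habove _ _ ax) lam_le|_]; last first.
  by rewrite !mulr_ge0 ?powR_ge0 // ltW.
rewrite !normcM hg mulrC -!mulrA; apply: ler_pM; rewrite ?normc_ge0 ?mulr_ge0 ?normc_ge0 //.
rewrite -/(a x) -/(a y) -powRM //.
have P0 : 0 < a x * a y by apply: lt_le_trans lam_le.
rewrite -{1}[a x * a y](@powRr1 _) ?(ltW P0) //.
rewrite -{1}[1](subrK s) powRD; last by rewrite (gt_eqF P0) implybT.
rewrite ler_wpM2r ?powR_ge0 //.
rewrite -opprB !powRN lef_pV2 ?posrE ?powR_gt0 //.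
by apply: ge0_ler_powR; rewrite ?nnegrE ?subr_ge0 ?(ltW s1) ?(ltW lam0) ?(ltW P0).
Qed.

(** Freezing the first modulus to its dyadic level turns the cut-off into a
    condition on eta alone, so that the form splits into products of functions, to
    which the l^2 bound applies. The weights t_k of the l^2 bound are
    proportional to (m k)^(s-2): this turns |g|^2 on level k into |g|^s, and makes the sum of
    (m k)^(2-s) over the levels below lam / |g eta| geometric. *)
Lemma below_cut_bound (M lam : R) (l : T -> nat) : 0 < M -> 0 < lam ->
  let m k := M * 2^-1 ^+ k in
  (forall x, 0 < a x -> m (l x) <= a x <= 2 * m (l x)) ->
  normc (\sum_x \sum_(y | m (l x) * a y <= lam) g x * h y * K x y)
    <= B * lam `^ (1 - s / 2) * interp_const s * S.
Proof.
move=> M0 lam0 m hl; have a0 z : 0 <= a z by exact: normc_ge0.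
have m0 k : 0 < m k by rewrite mulr_gt0 // exprn_gt0.
have e0 : 0 < 2 - s by rewrite subr_gt0.
have aM x : a x `^ 2 = a x `^ (2 - s) * a x `^ s.
  have [->|ax] := eqVneq (a x) 0.
    by rewrite [in LHS]powR0 ?(@powR0 _ (2 - s)) ?mul0r // gt_eqF.
  by rewrite -powRD ?ax ?implybT // subrK.
pose L := (\max_x l x).+1.
have lL x : (l x < L)%N by rewrite ltnS /L leq_bigmax.
pose u k x := if l x == k then g x else 0.
pose v k y := if m k * a y <= lam then h y else 0.
have -> : \sum_x \sum_(y | m (l x) * a y <= lam) g x * h y * K x y
   = \sum_(k < L) form (u k) (v k).
  rewrite /form exchange_big /=; apply: eq_bigr => x _.
  rewrite exchange_big /= big_mkcond; apply: eq_bigr => y _.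
  rewrite (bigD1 (Ordinal (lL x))) //= big1 ?addr0 => [|k kx].
    by rewrite /u /v eqxx; case: ifP; rewrite // mulr0 mul0r.
  rewrite /u ifN ?mul0r //; apply: contraNneq kx => lx.
  by apply/eqP/val_inj.
(* Up to constants, tau equalises the two terms of the l^2 bound after
   summation. *)
pose tau := lam `^ (1 - s / 2).
have tau0 : 0 < tau by exact: powR_gt0.
pose t k := tau / m k `^ (2 - s).
have t0 k : 0 < t k by rewrite divr_gt0 ?powR_gt0.
apply: le_trans (normc_sum _ _) _.
apply: (@le_trans _ _ (\sum_(k < L) B / 2 *
   (t k * \sum_x normc (u k x) ^+ 2 + (t k)^-1 * \sum_y normc (v k y) ^+ 2))).
  by apply: ler_sum => k _; exact: KB.
rewrite -mulr_sumr big_split /=.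
have hu : \sum_(k < L) t k * \sum_x normc (u k x) ^+ 2 <= tau * 2 `^ (2 - s) * S.
  under eq_bigr => k _ do rewrite mulr_sumr.
  rewrite exchange_big mulr_sumr /=; apply: ler_sum => x _.
  rewrite (bigD1 (Ordinal (lL x))) //= big1 ?addr0 => [|k kx]; last first.
    rewrite /u ifN ?normc0 ?expr0n ?mulr0 //; apply: contraNneq kx => lx.
    by apply/eqP/val_inj.
  rewrite /u eqxx -/(a x) /t -!mulrA ler_pM2l // -powR_mulrn // aM.
  rewrite mulrA ler_wpM2r ?powR_ge0 // mulrC ler_pdivrMr ?powR_gt0 //.
  have [ax|] := boolP (0 < a x); last first.
    by rewrite lt0r a0 andbT negbK => /eqP ->; rewrite powR0 ?gt_eqF // mulr_ge0 ?powR_ge0.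
  rewrite -powRM ?(ltW (m0 _)) //; have /andP[_ ax2] := hl x ax.
  apply: ge0_ler_powR => //; rewrite ?nnegrE; [exact: ltW|exact: a0|].
  by apply: mulr_ge0 => //; exact: ltW.
pose rho : R := 2^-1 `^ (2 - s).
have rho1 : rho < 1 by exact: half_powR_lt1.
have hv : \sum_(k < L) (t k)^-1 * \sum_y normc (v k y) ^+ 2
   <= tau * (1 - rho)^-1 * S.
  under eq_bigr => k _ do rewrite mulr_sumr.
  rewrite exchange_big mulr_sumr /=; apply: ler_sum => y _.
  have [ay|] := boolP (0 < a y); last first.
    rewrite lt0r a0 andbT negbK => /eqP ay0.
    rewrite big1 => [|k _]; first by rewrite !mulr_ge0 ?powR_ge0 ?invr_ge0 ?subr_ge0 ?ltW.
    by rewrite /v; case: ifP => _; rewrite ?hg -/(a y) ?ay0 ?normc0 expr0n ?mulr0.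
  have -> : \sum_(k < L) (t k)^-1 * normc (v k y) ^+ 2 =
     a y ^+ 2 / tau * \sum_(k < L | M `^ (2 - s) * rho ^+ k <= (lam / a y) `^ (2 - s))
        M `^ (2 - s) * rho ^+ k.
    rewrite [in RHS]big_mkcond mulr_sumr; apply: eq_bigr => k _ /=.
    have <- : m k `^ (2 - s) = M `^ (2 - s) * rho ^+ k.
      rewrite /m powRM ?(ltW M0) ?exprn_ge0 ?invr_ge0 //; congr (_ * _).
      rewrite -!powR_mulrn ?powR_ge0 ?invr_ge0 //; exact: powRAC.
    have -> : (m k `^ (2 - s) <= (lam / a y) `^ (2 - s)) = (m k * a y <= lam).
      rewrite -ler_pdivlMr //; apply/idP/idP; last first.
        by apply: ge0_ler_powR; rewrite ?nnegrE ?divr_ge0 ?(ltW e0) ?(ltW (m0 _)) ?(ltW lam0).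
      apply: contraLR; rewrite -!ltNge.
      by apply: gt0_ltr_powR; rewrite ?nnegrE ?divr_ge0 ?(ltW (m0 _)) ?(ltW lam0).
    rewrite /v; case: ifP => _; last by rewrite normc0 expr0n /= !mulr0.
    by rewrite hg /t invf_div mulrC mulrA mulrAC.
  apply: (@le_trans _ _ (a y ^+ 2 / tau * ((lam / a y) `^ (2 - s) / (1 - rho)))).
    apply: ler_wpM2l; first by rewrite divr_ge0 ?sqr_ge0 // ltW.
    by apply: geometric_sum_below; rewrite ?powR_ge0.
  rewrite -powR_mulrn // aM powRM ?invr_ge0 ?(ltW lam0) //.
  have -> : (a y)^-1 `^ (2 - s) = (a y `^ (2 - s))^-1.
    by rewrite -(powR_inv1 (a0 y)) powRAC powR_inv1 ?powR_ge0.
  have -> : lam `^ (2 - s) = tau ^+ 2.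
    by rewrite -powR_mulrn ?powR_ge0 // -powRrM; congr powR; field.
  have : a y `^ (2 - s) != 0 by rewrite gt_eqF ?powR_gt0.
  have : tau != 0 by rewrite gt_eqF.
  have : 1 - rho != 0 by rewrite gt_eqF ?subr_gt0.
  by move=> n1 n2 n3; rewrite le_eqVlt; apply/orP; left; apply/eqP; field; rewrite n1 n2 n3.
apply: le_trans (ler_wpM2l _ (lerD hu hv)) _; first by rewrite divr_ge0 ?(ltW B0).
by rewrite /interp_const -/tau -/rho le_eqVlt; apply/orP; left; apply/eqP; ring.
Qed.

(** The endpoint case of Marcinkiewicz interpolation between (l^1, l^1) and
    (l^2, l^2) for a bilinear form. *)
Lemma bilinear_interpolation :
  normc (form g h) <=
  (1 + interp_const s) * A `^ (2 / s - 1) * B `^ (2 - 2 / s) * S `^ (2 / s).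
Proof.
have s0 : 0 < s by exact: lt_trans s1.
have a0 z : 0 <= a z by exact: normc_ge0.
have [S0|S0] := eqVneq S 0.
  have g0 x : g x = 0.
    apply: eq0_normc; apply: (@powR_eq0_eq0 _ _ s).
    by apply: (psumr_eq0P _ S0) => // y _; exact: powR_ge0.
  rewrite /form big1 ?normc0 => [|x _]; last by rewrite big1 // => y _; rewrite g0 !mul0r.
  by rewrite !mulr_ge0 ?powR_ge0 // addr_ge0 // interp_const_ge0.
have {}S0 : 0 < S by rewrite lt0r S0 sumr_ge0 // => x _; exact: powR_ge0.
(* The summand 1 keeps the top level M positive. *)
pose M : R := 1 + \sum_x a x.
have M0 : 0 < M by rewrite ltr_wpDr // sumr_ge0.
pose m k := M * 2^-1 ^+ k.
have ex x : exists k, 0 < a x -> m k <= a x <= 2 * m k.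
  have [ax|_] := boolP (0 < a x); last by exists 0%N.
  have [|k hk] := @dyadic_level _ M _ ax; last by exists k.
  rewrite (@le_trans _ _ M) ?ler_peMl ?ler1n ?(ltW M0) //.
  by rewrite /M (bigD1 x) //= addrCA lerDl addr_ge0 // sumr_ge0.
have [l hl] := choice ex.
(* This lam equalises A lam^(1-s) S^2 and B lam^(1-s/2) S. *)
pose lam := (A * S / B) `^ (2 / s).
have ASB : 0 < A * S / B by rewrite divr_gt0 ?mulr_gt0.
have lam0 : 0 < lam by exact: powR_gt0.
have -> : form g h =
  \sum_x \sum_(y | m (l x) * a y <= lam) g x * h y * K x y +
  \sum_x \sum_(y | ~~ (m (l x) * a y <= lam)) g x * h y * K x y.
  rewrite -big_split; apply: eq_bigr => x _ /=.
  by rewrite (bigID (fun y => m (l x) * a y <= lam)).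
apply: le_trans (normcD_le _ _) _.
have := below_cut_bound M0 lam0 hl.
have : normc (\sum_x \sum_(y | ~~ (m (l x) * a y <= lam)) g x * h y * K x y)
  <= A * lam `^ (1 - s) * S ^+ 2.
  apply: (@above_cut_bound (fun x y => ~~ (m (l x) * a y <= lam)) _ lam0) => x y ax.
  rewrite -ltNge => /ltW /le_trans; apply; apply: ler_wpM2r => //.
  by have /andP[] := hl x ax.
move=> above_le below_le; apply: le_trans (lerD below_le above_le) _.
have powDn (c e : R) k : 0 < c -> c `^ (e + k%:R) = c `^ e * c ^+ k.
  by move=> c0; rewrite powRD ?powR_mulrn ?(ltW c0) // (gt_eqF c0) implybT.
have powV (c e : R) : 0 < c -> c^-1 `^ e = (c `^ e)^-1.
  by move=> c0; rewrite -(powR_inv1 (ltW c0)) powRAC powR_inv1 ?powR_ge0.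
have lamE e : lam `^ e = A `^ (2 / s * e) * S `^ (2 / s * e) / B `^ (2 / s * e).
  by rewrite /lam -powRrM !powRM ?mulr_ge0 ?invr_ge0 ?(ltW A0) ?(ltW B0) ?(ltW S0) // powV.
rewrite !lamE.
have -> : 2 / s * (1 - s / 2) = 2 / s - 1 by field; rewrite gt_eqF.
have -> : 2 / s * (1 - s) = 2 / s - 2%:R by field; rewrite gt_eqF.
have -> : 2 - 2 / s = - (2 / s) + 2%:R by ring.
have E1 c : 0 < c -> c `^ (2 / s - 1) = c `^ (2 / s) / c.
  by move=> c0; rewrite powRB ?powRr1 ?(ltW c0) // (gt_eqF c0) implybT.
have E2 c : 0 < c -> c `^ (2 / s - 2%:R) = c `^ (2 / s) / c ^+ 2.
  by move=> c0; rewrite powRB ?powR_mulrn ?(ltW c0) // (gt_eqF c0) implybT.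
rewrite !E1 // !E2 // powDn // powRN.
have PA : A `^ (2 / s) != 0 by rewrite gt_eqF ?powR_gt0.
have PB : B `^ (2 / s) != 0 by rewrite gt_eqF ?powR_gt0.
have nA : A != 0 by rewrite gt_eqF.
have nB : B != 0 by rewrite gt_eqF.
have nS : S != 0 by rewrite gt_eqF.
rewrite le_eqVlt; apply/orP; left; apply/eqP; field.
by rewrite PB nA nB nS.
Qed.

End Interpolation.

(** * Complex moduli and the characters of the prime field *)

Lemma mul_conjc (R : rcfType) (z : R[i]) : z * z^* = (normc z ^+ 2)%:C.
Proof. by rewrite -sqr_normc rmorphXn. Qed.

Lemma normc_conj (R : rcfType) (z : R[i]) : normc z^* = normc z.
Proof. by case: z => a b /=; rewrite sqrrN. Qed.

Lemma normc_real (R : rcfType) (a : R) : normc a%:C = `|a|.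
Proof. by rewrite /= expr0n addr0 sqrtr_sqr. Qed.

Definition cis (R : realType) (theta : R) : R[i] := cos theta +i* sin theta.

Lemma cisD (R : realType) (a b : R) : cis (a + b) = cis a * cis b.
Proof.
rewrite /cis cosD sinD /=; apply/eqP; rewrite eq_complex /= eqxx /=.
by rewrite addrC.
Qed.

Lemma cis_periodic (R : realType) (a : R) k : cis (a + pi *+ 2 *+ k) = cis a.
Proof. by rewrite /cis (periodicn (@cosD2pi R)) (periodicn (@sinD2pi R)). Qed.

(** Reducing a sum of representatives modulo p changes the angle by a multiple
    of 2 pi. *)
Lemma echarD (R : realType) (p : nat) (s t : 'F_p) : prime p ->
  echar R (s + t) = echar R s * echar R t.
Proof.
move=> pp; rewrite /echar -!/(cis _) -cisD.
have -> : nat_of_ord (s + t) = ((s + t)%N %% p)%N by rewrite /= [X in (_ %% X)%N]Fp_cast.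
rewrite -(cis_periodic _ ((s + t) %/ p)); congr cis.
have p0 : (p%:R : R) != 0 by rewrite pnatr_eq0 -lt0n prime_gt0.
have -> : 2 * pi * (s : nat)%:R / p%:R + 2 * pi * (t : nat)%:R / p%:R =
  2 * pi * (s + t)%N%:R / p%:R :> R by rewrite natrD; field.
rewrite [in RHS](divn_eq (s + t)%N p) natrD natrM -mulr_natr -(mulr_natr _ 2).
by field.
Qed.

Lemma normc_echar (R : realType) (p : nat) (t : 'F_p) : normc (echar R t) = 1.
Proof. by rewrite /echar /= cos2Dsin2 sqrtr1. Qed.

Lemma echar0 (R : realType) (p : nat) : echar R (0 : 'F_p) = 1.
Proof. by rewrite /echar /= mulr0 mul0r cos0 sin0. Qed.

Lemma echarN (R : realType) (p : nat) (t : 'F_p) : prime p ->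
  echar R (- t) = (echar R t)^*.
Proof.
move=> pp; have e1 : echar R t * (echar R t)^* = 1.
  by rewrite mul_conjc normc_echar expr1n.
by rewrite -[LHS]mulr1 -e1 mulrA -echarD // addNr echar0 mul1r.
Qed.

(** The angle 2 pi / p lies in ]0, pi], where cosine is injective. *)
Lemma echar1_neq1 (R : realType) (p : nat) : prime p -> echar R (1 : 'F_p) != 1.
Proof.
move=> pp; rewrite /echar eq_complex /= negb_and; apply/orP; left.
have -> : (1 %% (Zp_trunc (pdiv p)).+2)%N = 1%N by [].
have p2 : 2 <= p%:R :> R by rewrite ler_nat; apply: prime_gt1.
have pgt0 : 0 < p%:R :> R by apply: lt_le_trans p2.
have pi0 := pi_gt0 R.
have th0 : 0 < 2 * pi / p%:R :> R by rewrite divr_gt0 ?mulr_gt0.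
have thpi : 2 * pi / p%:R <= pi :> R.
  by rewrite ler_pdivrMr // mulrC ler_pM2l.
rewrite mulr1; apply/eqP => h.
have : 2 * pi / p%:R = 0 :> R.
  by apply: (@cos_inj R); rewrite ?in_itv /= ?lexx ?(ltW th0) ?(ltW pi0) ?cos0.
by move/eqP; rewrite gt_eqF.
Qed.

(** * The Fourier transform *)

Section Fourier.
Variables (R : realType) (p n : nat).
Hypothesis pp : prime p.
Local Notation V := ('rV['F_p]_n).
Local Notation N := ((p ^ n)%:R : R).

Lemma dotpC (x y : V) : dotp x y = dotp y x.
Proof. by apply: eq_bigr => i _; rewrite mulrC. Qed.

Lemma dotpDr (x y z : V) : dotp x (y + z) = dotp x y + dotp x z.
Proof. by rewrite -big_split; apply: eq_bigr => i _; rewrite mxE mulrDr. Qed.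

Lemma dotpNr (x y : V) : dotp x (- y) = - dotp x y.
Proof. by rewrite -sumrN; apply: eq_bigr => i _; rewrite mxE mulrN. Qed.

Lemma card_space : #|{: V}| = (p ^ n)%N.
Proof. by rewrite card_mx mul1n card_Fp. Qed.

(** Orthogonality of characters: translating by a vector y whose product with
    xi is -1 multiplies the sum by a root of unity different from 1. *)
Lemma fourier_one (xi : V) :
  fourier (fun=> 1 : R[i]) xi = if xi == 0 then N%:C else 0.
Proof.
rewrite /fourier; under eq_bigr => x _ do rewrite mulr1 -dotpNr.
have [->|xi0] := eqVneq.
  under eq_bigr => x _.
    rewrite (_ : dotp x _ = 0) ?echar0; first by over.
    by rewrite /dotp big1 // => i _; rewrite oppr0 mxE mulr0.
  by rewrite sumr_const card_space rmorph_nat.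
have /rV0Pn[i xii] := xi0.
pose y : V := \row_j (if j == i then - (xi ord0 i)^-1 else 0).
have yxi : dotp y (- xi) = 1.
  rewrite /dotp (bigD1 i) //= big1 => [|j ji].
    by rewrite !mxE eqxx mulrNN mulVf ?addr0.
  by rewrite !mxE (negbTE ji) mul0r.
apply/eqP; set s := \sum_x _.
have : echar R (1 : 'F_p) * s = s.
  rewrite {2}/s (reindex_inj (addIr y)) /= mulr_sumr; apply: eq_bigr => x _.
  by rewrite [dotp (x + y) _]dotpC dotpDr -yxi -echarD // addrC ![dotp (- xi) _]dotpC.
move/eqP; rewrite -subr_eq0 -[X in _ - X]mul1r -mulrBl mulf_eq0 subr_eq0.
by rewrite (negbTE (echar1_neq1 R pp)).
Qed.

Lemma fourier_transpose (u v : V -> R[i]) :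
  \sum_xi u xi * fourier v xi = \sum_x v x * fourier u x.
Proof.
under eq_bigr => xi _ do rewrite mulr_sumr.
rewrite exchange_big; apply: eq_bigr => x _; rewrite mulr_sumr.
by apply: eq_bigr => xi _; rewrite dotpC mulrCA mulrA mulrC mulrA mulrAC.
Qed.

Lemma fourier_conj (u : V -> R[i]) x :
  fourier (fun y => (u y)^*) (- x) = (fourier u x)^*.
Proof.
rewrite /fourier rmorph_sum; apply: eq_bigr => y _.
by rewrite rmorphM dotpNr echarN.
Qed.

(** This identity is used in both directions: with w = 1 it yields Plancherel,
    and with w = mu - 1/N it identifies the form controlled by interpolation. *)
Lemma fourier_form (w u v : V -> R[i]) :
  \sum_xi \sum_eta u xi * v eta * fourier w (eta - xi) =
  \sum_x fourier u (- x) * fourier v x * w x.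
Proof.
under eq_bigr => xi _ do under eq_bigr => eta _ do rewrite mulr_sumr.
under eq_bigr => xi _ do rewrite exchange_big.
rewrite exchange_big; apply: eq_bigr => x _.
rewrite mulr_suml mulr_suml; apply: eq_bigr => xi _.
rewrite mulr_sumr mulr_suml; apply: eq_bigr => eta _.
rewrite dotpDr dotpNr opprD echarD // ![dotp x _]dotpC dotpNr.
by ring.
Qed.

Lemma plancherel (u : V -> R[i]) :
  \sum_x normc (fourier u x) ^+ 2 = N * \sum_xi normc (u xi) ^+ 2.
Proof.
apply: (@complexI R); rewrite rmorphM !rmorph_sum /=.
have -> : \sum_x (normc (fourier u x) ^+ 2)%:C =
    \sum_x fourier (fun y => (u y)^*) (- x) * fourier u x * 1.
  by apply: eq_bigr => x _; rewrite -mul_conjc fourier_conj mulr1 mulrC.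
rewrite -(fourier_form (fun=> 1)) mulr_sumr; apply: eq_bigr => xi _.
rewrite (bigD1 xi) //= big1 => [|eta ne]; last first.
  by rewrite fourier_one subr_eq0 (negbTE ne) mulr0.
by rewrite addr0 fourier_one subrr eqxx -mul_conjc mulrC [_^* * _]mulrC.
Qed.

Lemma fourierB (u v : V -> R[i]) x :
  fourier (fun y => u y - v y) x = fourier u x - fourier v x.
Proof. by rewrite -sumrB; apply: eq_bigr => y _; rewrite mulrBr. Qed.

Lemma fourierZ (c : R[i]) (u : V -> R[i]) x :
  fourier (fun y => c * u y) x = c * fourier u x.
Proof. by rewrite mulr_sumr; apply: eq_bigr => y _; rewrite mulrCA. Qed.

Lemma fourier0 (u : V -> R[i]) : fourier u 0 = \sum_x u x.
Proof.
apply: eq_bigr => x _; rewrite (_ : dotp x 0 = 0) ?oppr0 ?echar0 ?mul1r //.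
by rewrite /dotp big1 // => i _; rewrite mxE mulr0.
Qed.

(** The product inequality 2ab <= t a^2 + b^2 / t stands in for Cauchy-Schwarz:
    the free parameter t is what the dyadic argument tunes level by level. *)
Lemma fourier_form_l2 (w : V -> R) (B t : R) (u v : V -> R[i]) :
  (forall x, N * `|w x| <= B) -> 0 < t ->
  normc (\sum_xi \sum_eta u xi * v eta * fourier (fun x => (w x)%:C) (eta - xi))
  <= B / 2 * (t * \sum_x normc (u x) ^+ 2 + t^-1 * \sum_y normc (v y) ^+ 2).
Proof.
move=> wB t0; have N0 : 0 < N by rewrite ltr0n expn_gt0 prime_gt0.
rewrite fourier_form; apply: le_trans (normc_sum _ _) _.
pose U x := normc (fourier u (- x)); pose W x := normc (fourier v x).
apply: (@le_trans _ _ (\sum_x B / N / 2 * (t * U x ^+ 2 + t^-1 * W x ^+ 2))).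
  apply: ler_sum => x _; rewrite !normcM normc_real -/(U x) -/(W x).
  have U0 : 0 <= U x by exact: normc_ge0.
  have W0 : 0 <= W x by exact: normc_ge0.
  rewrite mulrC -mulrA; apply: ler_pM; rewrite ?mulr_ge0 //.
    by rewrite ler_pdivlMr // mulrC.
  have -> : 2^-1 * (t * U x ^+ 2 + t^-1 * W x ^+ 2) =
      U x * W x + (t * U x - W x) ^+ 2 / (2 * t) by field; rewrite gt_eqF.
  by rewrite lerDl divr_ge0 ?sqr_ge0 // mulr_ge0 // ltW.
rewrite -mulr_sumr big_split /= -!mulr_sumr plancherel.
have -> : \sum_x U x ^+ 2 = N * \sum_x normc (u x) ^+ 2.
  by rewrite -plancherel [RHS](reindex_inj oppr_inj).
rewrite le_eqVlt; apply/orP; left; apply/eqP; field.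
by rewrite !gt_eqF.
Qed.

End Fourier.

(** * The extension inequality *)

Section Extension.
Variables (R : realType) (p n : nat).
Hypothesis pp : prime p.
Local Notation V := ('rV['F_p]_n).
Local Notation N := ((p ^ n)%:R : R).

(** The inequality dual to the extension inequality. Splitting mu as
    1/N + nu gives the summand 1 of the constant by Plancherel, and the other
    summand by interpolation of the form with kernel the transform of nu. *)
Lemma dual_estimate (mu : V -> R) (A B s : R) :
  probability_density mu -> 0 < A -> 0 < B -> 1 < s -> s < 2 ->
  (forall x, N * `|mu x - N^-1| <= B) ->
  (forall xi, xi != 0 -> normc (fourier (fun x => (mu x)%:C) xi) <= A) ->
  forall g : V -> R[i],
  \sum_x normc (fourier g x) ^+ 2 * mu x <=
  (1 + (1 + interp_const s) * A `^ (2 / s - 1) * B `^ (2 - 2 / s))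
    * (\sum_xi normc (g xi) `^ s) `^ (2 / s).
Proof.
move=> [mu0 mu1] A0 B0 s1 s2 muB muA g.
have s0 : 0 < s by exact: lt_trans s1.
have N0 : N != 0 by rewrite pnatr_eq0 -lt0n expn_gt0 prime_gt0.
pose nu x := mu x - N^-1.
pose K xi eta := fourier (fun x : V => (nu x)%:C) (eta - xi).
have nuE zeta : fourier (fun x : V => (nu x)%:C) zeta =
    fourier (fun x => (mu x)%:C) zeta - (N^-1)%:C * fourier (fun=> 1) zeta.
  rewrite -fourierZ -fourierB; apply: eq_bigr => x _.
  by rewrite mulr1 -rmorphB.
have KA xi eta : normc (K xi eta) <= A.
  rewrite /K nuE fourier_one //; have [->|ne] := eqVneq.
    rewrite fourier0 -(rmorph_sum (real_complex R)) mu1 -rmorphM mulVf // subrr normc0.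
    exact: ltW.
  by rewrite mulr0 subr0 muA.
have KB u v t (t0 : 0 < t) := @fourier_form_l2 R p n pp nu B t u v muB t0.
have cg x : normc (g x) = normc (g x)^* by rewrite normc_conj.
have := bilinear_interpolation A0 B0 s1 s2 KA KB cg.
set b := \sum_x \sum_y _.
have bE : b = \sum_x (normc (fourier g x) ^+ 2 * nu x)%:C.
  rewrite /b /K fourier_form //; apply: eq_bigr => x _.
  by rewrite fourier_conj // [_^* * _]mulrC mul_conjc -rmorphM.
have -> : \sum_x normc (fourier g x) ^+ 2 * mu x =
  \sum_xi normc (g xi) ^+ 2 + \sum_x normc (fourier g x) ^+ 2 * nu x.
  rewrite -[\sum_xi normc (g xi) ^+ 2](mulKf N0) -plancherel // mulr_sumr -big_split.
  by apply: eq_bigr => x _ /=; rewrite /nu; ring.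
rewrite bE -(rmorph_sum (real_complex R)) normc_real => bA.
rewrite mulrDl mul1r; apply: lerD; last first.
  apply: le_trans (ler_norm _) _; apply: le_trans bA _.
  by under eq_bigr => x _ do rewrite normc_conj.
have := @sum_powR_le R V (fun xi => normc (g xi) `^ s) (2 / s).
rewrite ler_pdivlMr // mul1r => /(_ (fun _ => powR_ge0 _ _) (ltW s2)).
apply: le_trans; apply: ler_sum => xi _.
rewrite -powRrM; have -> : s * (2 / s) = 2%:R by field; rewrite gt_eqF.
by rewrite powR_mulrn ?normc_ge0.
Qed.

(** With F the transform of f mu and S the sum of |F|^q, test the dual inequality
    on g = |F|^(q-2) conj(F), for which |g|^(q/(q-1)) = |F|^q and g F = |F|^q.
    Transposing the transform bounds S by the L^2(mu) pairing of f with the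
    transform of g. *)
Lemma extension_of_dual (mu : V -> R) (D q : R) :
  (forall x, 0 <= mu x) -> 2 < q -> 0 <= D ->
  (forall g : V -> R[i],
    \sum_x normc (fourier g x) ^+ 2 * mu x <=
    D * (\sum_xi normc (g xi) `^ (q / (q - 1))) `^ (2 / (q / (q - 1)))) ->
  forall f : V -> R[i],
  (\sum_xi normc (fourier (fun x => f x * (mu x)%:C) xi) `^ q) `^ (2 / q) <=
  D * \sum_x normc (f x) ^+ 2 * mu x.
Proof.
move=> mu0 q2 D0 hD f; set F := fourier _.
have q0 : 0 < q by exact: lt_trans q2.
have q1 : 0 < q - 1 by rewrite subr_gt0; apply: lt_trans q2; rewrite ltr1n.
set S := \sum_xi _; set X := \sum_x _.
have X0 : 0 <= X by apply: sumr_ge0 => x _; rewrite mulr_ge0 ?sqr_ge0.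
have [->|S0] := eqVneq S 0; first by rewrite powR0 ?mulr_ge0 // gt_eqF ?divr_gt0.
have {}S0 : 0 < S by rewrite lt0r S0 sumr_ge0 // => xi _; exact: powR_ge0.
pose g xi := (normc (F xi) `^ (q - 2))%:C * (F xi)^*.
have gF xi : g xi * F xi = (normc (F xi) `^ q)%:C.
  rewrite /g -mulrA [_^* * _]mulrC mul_conjc -rmorphM; congr _%:C.
  have [->|Fn] := eqVneq (normc (F xi)) 0; first by rewrite expr0n mulr0 powR0 ?gt_eqF.
  by rewrite -powR_mulrn ?normc_ge0 // -powRD ?subrK // Fn implybT.
have gn xi : normc (g xi) `^ (q / (q - 1)) = normc (F xi) `^ q.
  rewrite /g normcM normc_real normc_conj ger0_norm ?powR_ge0 //.
  have -> : normc (F xi) `^ (q - 2) * normc (F xi) = normc (F xi) `^ (q - 1).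
    rewrite mulrC -(@mulr_powRB1 _ _ (q - 1)) ?normc_ge0 //.
    by congr (_ * _ `^ _); ring.
  by rewrite -powRrM; congr powR; field; rewrite gt_eqF.
have Y := hD g; rewrite (eq_bigr _ (fun xi _ => gn xi)) -/S in Y.
have SE : S%:C = \sum_x f x * (mu x)%:C * fourier g x.
  by rewrite -fourier_transpose rmorph_sum; apply: eq_bigr => xi _; rewrite gF.
set e := 2 / (q / (q - 1)) in Y.
have DSe : 0 <= D * S `^ e by rewrite mulr_ge0 ?powR_ge0.
have key t : 0 < t -> S <= (t * X + t^-1 * (D * S `^ e)) / 2.
  move=> t0; apply: (@le_trans _ _ (normc S%:C)); first by rewrite normc_real ler_norm.
  rewrite SE; apply: le_trans (normc_sum _ _) _.
  apply: (@le_trans _ _ ((t * X + t^-1 * \sum_x normc (fourier g x) ^+ 2 * mu x) / 2)).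
    rewrite /X !mulr_sumr -big_split mulr_suml; apply: ler_sum => x _ /=.
    rewrite !normcM normc_real ger0_norm //.
    set a := normc (f x); set c := normc _.
    rewrite -subr_ge0; set d := (X in 0 <= X).
    have -> : d = (t * a - c) ^+ 2 / (2 * t) * mu x.
      by rewrite /d; field; rewrite gt_eqF.
    apply: mulr_ge0 => //; apply: divr_ge0; first exact: sqr_ge0.
    by apply: mulr_ge0 => //; exact: ltW.
  by rewrite ler_pM2r ?invr_gt0 // lerD2l ler_pM2l ?invr_gt0.
(* If D were 0, key with a small t would give S < S. *)
have D1 : 0 < D.
  rewrite lt0r D0 andbT; apply/eqP => DE.
  have := key (S / (X + 1)); rewrite divr_gt0 ?ltr_wpDl // => /(_ isT).
  rewrite DE mul0r mulr0 addr0 leNgt => /negP; apply.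
  have X1 : 0 < X + 1 by rewrite ltr_wpDl.
  have -> : S / (X + 1) * X / 2 = S * (X / (2 * (X + 1))) by field; rewrite gt_eqF.
  rewrite gtr_pMr // ltr_pdivrMr ?mulr_gt0 // mul1r mulrDr mulr1.
  by apply: (@le_lt_trans _ _ (2 * X)); rewrite ?ltrDl // ler_peMl // ler1n.
have Se : 0 < S `^ e by exact: powR_gt0.
(* For this t the second term of key is S / 2, which is absorbed on the left. *)
have := key (D * S `^ e / S); rewrite divr_gt0 ?mulr_gt0 // => /(_ isT).
have -> : (D * S `^ e / S)^-1 * (D * S `^ e) = S.
  by field; rewrite !gt_eqF.
have -> : 2 / q = 2%:R - e by rewrite /e; field; rewrite !gt_eqF.
rewrite powRB ?powR_mulrn ?(ltW S0) ?(gt_eqF S0) ?implybT // ler_pdivrMr //.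
have -> : D * S `^ e / S * X = D * X * S `^ e / S by ring.
rewrite ler_pdivlMr // => h.
have {h} : S <= D * X * S `^ e / S by lra.
by rewrite ler_pdivlMr // -expr2.
Qed.

End Extension.

Lemma Lqnorm_counting_le (R : realType) (T : finType) (r : R) (q : \bar R)
    (f : T -> R[i]) : 0 < r -> (r%:E <= q)%E ->
  Lqnorm (fun=> 1) q f <= (\sum_x normc (f x) `^ r) `^ r^-1.
Proof.
move=> r0; have f0 x : 0 <= normc (f x) `^ r by exact: powR_ge0.
case: q => [q|_|//] /=.
  rewrite lee_fin => rq; have q0 : 0 < q by exact: lt_le_trans rq.
  have -> : r^-1 = q / r * q^-1 by field; rewrite !gt_eqF.
  rewrite powRrM; apply: ge0_ler_powR; rewrite ?nnegrE ?powR_ge0 ?invr_ge0 ?(ltW q0) //.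
    by apply: sumr_ge0 => x _; rewrite mulr1 powR_ge0.
  have := @sum_powR_le R T (fun x => normc (f x) `^ r) (q / r) f0.
  rewrite ler_pdivlMr // mul1r => /(_ rq); apply: le_trans.
  rewrite le_eqVlt; apply/orP; left; apply/eqP; apply: eq_bigr => x _.
  by rewrite mulr1 -powRrM; congr powR; field; rewrite gt_eqF.
apply: bigmax_le => [|x _]; first exact: powR_ge0.
rewrite -[leLHS]powRr1 ?normc_ge0 // -(divff (lt0r_neq0 r0)) powRrM.
apply: ge0_ler_powR; rewrite ?nnegrE ?invr_ge0 ?(ltW r0) ?sumr_ge0 //.
by rewrite (bigD1 x) //= lerDl sumr_ge0.
Qed.

Theorem theorem1p3 (R : realType) (n : nat) (alpha beta C1 C2 : R)
    (hn : (1 <= n)%N)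
    (halpha0 : 0 < alpha) (halphan : alpha < n%:R)
    (hbeta0 : 0 < beta) (hbetan : beta < n%:R)
    (hC1 : 0 < C1) (hC2 : 0 < C2)
    (q : \bar R) (hq : ((qexp n alpha beta)%:E <= q)%E) :
  exists C : R,
    forall (p : nat), prime p ->
    forall (mu : 'rV['F_p]_n -> R),
      probability_density mu ->
      (forall x, mu x <= C1 * p%:R `^ (- alpha)) ->
      (forall xi, xi != 0 ->
        normc (fourier (fun x => (mu x)%:C) xi) <= C2 * p%:R `^ (- (beta / 2))) ->
      (Rstar mu 2%:E q <= C%:E)%E.
Proof.
set r := qexp n alpha beta in hq *.
have rE : r = 2 + 4 * (n%:R - alpha) / beta.
  by rewrite /r /qexp; field; rewrite gt_eqF.
have r2 : 2 < r by rewrite rE ltrDl divr_gt0 // mulr_gt0 // subr_gt0.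
have r0 : 0 < r by exact: lt_trans r2.
have r1 : 0 < r - 1 by rewrite subr_gt0; apply: lt_trans r2; rewrite ltr1n.
pose s := r / (r - 1).
have s1 : 1 < s by rewrite /s ltr_pdivlMr // mul1r gtrBl.
have s2 : s < 2 by rewrite /s ltr_pdivrMr // mulrBr mulr1 ltrBrDr mulr_natl mulr2n ltrD2l.
pose D := 1 + (1 + interp_const s) * (C2 `^ (2 / s - 1) * (C1 + 1) `^ (2 - 2 / s)).
have D0 : 0 <= D.
  by rewrite addr_ge0 // !mulr_ge0 ?powR_ge0 // addr_ge0 // interp_const_ge0.
exists (D `^ 2^-1) => p pp mu hmu muC1 muC2.
have [mu0 mu1] := hmu.
have p1 : 1 <= p%:R :> R by rewrite ler1n prime_gt0.
have p0 : 0 < p%:R :> R by exact: lt_le_trans p1.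
have C10 : 0 < C1 + 1 by rewrite addr_gt0.
have natpow : (p ^ n)%:R = p%:R `^ n%:R :> R by rewrite natrX powR_mulrn // ltW.
have N0 : 0 < (p ^ n)%:R :> R by rewrite natpow powR_gt0.
pose A := C2 * p%:R `^ (- (beta / 2)); pose B := (C1 + 1) * p%:R `^ (n%:R - alpha).
have A0 : 0 < A by rewrite mulr_gt0 ?powR_gt0.
have B0 : 0 < B by rewrite mulr_gt0 ?powR_gt0.
have muB x : (p ^ n)%:R * `|mu x - (p ^ n)%:R^-1| <= B.
  apply: (@le_trans _ _ ((p ^ n)%:R * (mu x + (p ^ n)%:R^-1))).
    rewrite ler_pM2l // (le_trans (ler_normB _ _)) //.
    by rewrite !ger0_norm // invr_ge0 ltW.
  rewrite mulrDr divff ?gt_eqF // /B mulrDl mul1r; apply: lerD.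
    rewrite powRD ?(gt_eqF p0) ?implybT // -natpow mulrCA ler_pM2l //; exact: muC1.
  by apply: (@le_trans _ _ (p%:R `^ 0)); [rewrite powRr0|rewrite ler_powR // subr_ge0 ltW].
have ABE : A `^ (2 / s - 1) * B `^ (2 - 2 / s) =
    C2 `^ (2 / s - 1) * (C1 + 1) `^ (2 - 2 / s).
  rewrite !powRM ?powR_ge0 ?(ltW hC2) ?(ltW C10) // mulrACA -!powRrM.
  rewrite -powRD ?(gt_eqF p0) ?implybT //.
  (* The choice of r makes the total power of p vanish. *)
  suff -> : - (beta / 2) * (2 / s - 1) + (n%:R - alpha) * (2 - 2 / s) = 0.
    by rewrite powRr0 mulr1.
  rewrite /s; have -> : n%:R - alpha = (r - 2) * beta / 4.
    by rewrite rE; field; rewrite gt_eqF.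
  by field; rewrite !gt_eqF.
have dual := dual_estimate pp hmu A0 B0 s1 s2 muB muC2.
have ext := @extension_of_dual R p n mu D r mu0 r2 D0.
apply: ereal_inf_lbound; exists (D `^ 2^-1) => //; split=> [|f]; first exact: powR_ge0.
apply: le_trans (Lqnorm_counting_le _ r0 hq) _ => /=.
have -> : r^-1 = 2 / r * 2^-1 by field; rewrite gt_eqF.
have f0 x : 0 <= normc (f x) `^ 2 * mu x by rewrite mulr_ge0 ?powR_ge0.
rewrite powRrM -powRM ?sumr_ge0 //.
apply: ge0_ler_powR; rewrite ?nnegrE ?invr_ge0 ?powR_ge0 ?mulr_ge0 ?sumr_ge0 //.
under [in leRHS]eq_bigr => x _ do rewrite powR_mulrn ?normc_ge0 //.
by apply: ext => g; rewrite /D -ABE mulrA; exact: dual.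
Qed.
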